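(* Let $\mathbb K$ be a field of characteristic $0$, let $\mathfrak a$ be a finite-dimensional Lie algebra over $\mathbb K$ admitting an invertible derivation $D$, and let $\theta\in Z^2(\mathfrak a,\mathfrak a^* )$ be a cyclic $2$-cocycle. Define $$\Theta(x,y,z)=\theta(Dx,y)(z)+\theta(Dy,z)(x)+\theta(Dz,x)(y),\qquad x,y,z\in\mathfrak a.$$ If $\Theta$ is a $3$-coboundary for the scalar cohomology of $\mathfrak a$, then the quadratic Lie algebra $T^*_\theta\mathfrak a$ admits a symplectic structure.
   Context: All Lie algebras are finite-dimensional over a field $\mathbb K$ of characteristic $0$. A quadratic Lie algebra $(\mathfrak g,B)$ is a Lie algebra $\mathfrak g$ with a non-degenerate symmetric bilinear form $B$ such that $B([x,y],z)=B(x,[y,z])$ for all $x,y,z$. A symplectic structure on a Lie algebra $\mathfrak g$ is a non-degenerate skew-symmetric bilinear form $\omega$ with $\omega([x,y],z)+\omega([y,z],x)+\omega([z,x],y)=0$ for all $x,y,z\in\mathfrak g$. A $2$-cocycle $\theta\in Z^2(\mathfrak a,\mathfrak a^* )$ (values in the coadjoint module) is a skew-symmetric bilinear map $\theta:\mathfrak a\times\mathfrak a\to\mathfrak a^*$ such that the cyclic sum over $(x,y,z)$ of $\theta([x,y],z)+\theta(x,y)\circ\mathrm{ad}(z)$ vanishes. It is cyclic if $\theta(x,y)(z)=\theta(y,z)(x)$ for all $x,y,z\in\mathfrak a$. The $T^*$-extension $T^*_\theta\mathfrak a$ is the vector space $\mathfrak a\oplus\mathfrak a^*$ with bracket $$[x+f,y+g]=[x,y]_{\mathfrak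 a}+\theta(x,y)+f\circ\mathrm{ad}_{\mathfrak a}(y)-g\circ\mathrm{ad}_{\mathfrak a}(x),\quad x,y\in\mathfrak a,\ f,g\in\mathfrak a^*;$$ when $\theta$ is cyclic it is a quadratic Lie algebra for the form $B(x+f,y+g)=f(y)+g(x)$. Scalar cohomology is Chevalley–Eilenberg cohomology with coefficients in the trivial module $\mathbb K$: an alternating trilinear form $\Theta$ on $\mathfrak a$ is a $3$-coboundary if there is an alternating bilinear form $F$ on $\mathfrak a$ with $\Theta(x,y,z)=F([x,y],z)+F([y,z],x)+F([z,x],y)$ for all $x,y,z$ (up to an overall sign convention). *)

(* Defs.v *)
From HB Require Import structures.
From mathcomp Require Import all_boot all_order all_algebra.
From mathcomp Require Import sesquilinear ring.

Set Implicit Arguments.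
Unset Strict Implicit.
Unset Printing Implicit Defensive.

Import GRing.Theory.
Local Open Scope ring_scope.

HB.mixin Record Vector_isLieAlgebra (K : fieldType) g of Vector K g := {
  lie : {bilinear g -> g -> g};
  liexx : forall x, lie x x = 0;
  lie_jacobi : forall x y z,
    lie (lie x y) z + lie (lie y z) x + lie (lie z x) y = 0
}.

#[short(type="lieAlgType")]
HB.structure Definition LieAlgebra (K : fieldType) :=
  { g of Vector K g & Vector_isLieAlgebra K g }.

HB.mixin Record LieAlgebra_isQuadratic (K : fieldType) g of LieAlgebra K g := {
  quad_form : {symmetric g};
  quad_form_nondegenerate : nondegenerate quad_form;
  quad_form_invariant : forall x y z : g,
    quad_form (lie x y) z = quad_form x (lie y z)
}.

#[short(type="quadLieAlgType")]
HB.structure Definition QuadLieAlgebra (K : fieldType) :=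
  { g of LieAlgebra K g & LieAlgebra_isQuadratic K g }.

Section LieAlgebraDefs.
Variables (K : fieldType) (g : lieAlgType K).

Definition ad (x : g) : 'End(g) := linfun (lie x).

Definition derivation (D : 'End(g)) : Prop :=
  forall x y, D (lie x y) = lie (D x) y + lie x (D y).

Definition symplectic_structure (w : {skew_symmetric g}) : Prop :=
  nondegenerate w /\
  forall x y z, w (lie x y) z + w (lie y z) x + w (lie z x) y = 0.

(* Coboundaries for the trivial module K; the sign of the differential does
   not matter, since F can be replaced by - F. *)
Definition coboundary3 (T : g -> g -> g -> K) : Prop :=
  exists F : {biscalar g},
    (forall x, F x x = 0) /\
    forall x y z, T x y z = F (lie x y) z + F (lie y z) x + F (lie z x) y.

(* The elements of Z^2(g, g^* ), for the coadjoint module g^*. *)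
Record coad_cocycle2 := CoadCocycle2 {
  cocycle2_fun :> {bilinear g -> g -> 'Hom(g, K^o)};
  cocycle2_skew : forall x y, cocycle2_fun x y = - cocycle2_fun y x;
  cocycle2_eq : forall x y z,
    (cocycle2_fun (lie x y) z + (cocycle2_fun x y \o ad z)%VF) +
    (cocycle2_fun (lie y z) x + (cocycle2_fun y z \o ad x)%VF) +
    (cocycle2_fun (lie z x) y + (cocycle2_fun z x \o ad y)%VF) = 0
}.

Definition cyclic_cocycle (theta : coad_cocycle2) : Prop :=
  forall x y z, theta x y z = theta y z x.

End LieAlgebraDefs.

Section TstarExtension.
Variables (K : fieldType) (a : lieAlgType K).

(* The pair (x, f) stands for x + f. The hypothesis on the characteristic is
   what makes a skew-symmetric theta alternating, as needed for the bracket. *)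
Definition tstar of [pchar K] =i pred0 & coad_cocycle2 a : Type :=
  (a * 'Hom(a, K^o))%type.

Variables (charK : [pchar K] =i pred0) (theta : coad_cocycle2 a).

HB.instance Definition _ := Vector.on (tstar charK theta).

Definition tstar_lie (u v : tstar charK theta) : tstar charK theta :=
  (lie u.1 v.1,
   theta u.1 v.1 + (u.2 \o ad v.1)%VF - (v.2 \o ad u.1)%VF).

Definition tstar_form (u v : tstar charK theta) : K := u.2 v.1 + v.2 u.1.

Lemma adE (x y : a) : ad x y = lie x y.
Proof. by rewrite lfunE. Qed.

Lemma lieC (x y : a) : lie x y = - lie y x.
Proof.
apply/eqP; rewrite -addr_eq0; have := liexx (x + y).
by rewrite linearDl !linearDr !liexx add0r addr0 => ->.
Qed.

Lemma cocycle2_alternate (x : a) : theta x x = 0.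
Proof.
have /eqP := cocycle2_skew theta x x.
rewrite -addr_eq0 -mulr2n -scaler_nat scaler_eq0 => /orP[|/eqP//].
by have := charK 2; rewrite !inE /= => ->.
Qed.

Lemma lie_lie (x y z : a) : lie (lie x y) z = lie x (lie y z) - lie y (lie x z).
Proof.
have /eqP := lie_jacobi x y z; rewrite -addrA addr_eq0 => /eqP->.
by rewrite (lieC (lie y z)) (lieC (lie z x)) (lieC z x) linearNr opprD !opprK.
Qed.

Fact tstar_lie_bilinear : bilinear_for *:%R *:%R tstar_lie.
Proof.
have aux (k t t' f f' g g' : K) :
  k * t + t' + (k * f + f') - (k * g + g') = k * (t + f - g) + (t' + f' - g').
  by ring.
split=> [v k u w|u k v w]; congr (_, _); rewrite /= ?linearPl ?linearPr //;
  apply/lfunP=> z; rewrite !(lfun_simp, adE) /= linearPl linearP; exact: aux.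
Qed.

HB.instance Definition _ :=
  bilinear_isBilinear.Build K (tstar charK theta) (tstar charK theta)
    (tstar charK theta) *:%R *:%R tstar_lie tstar_lie_bilinear.

Fact tstar_liexx u : tstar_lie u u = 0.
Proof.
congr (_, _); first exact: liexx.
by rewrite cocycle2_alternate add0r subrr.
Qed.

Fact tstar_jacobi u v w :
  tstar_lie (tstar_lie u v) w + tstar_lie (tstar_lie v w) u
    + tstar_lie (tstar_lie w u) v = 0.
Proof.
have aux (t1 s1 t2 s2 t3 s3 f f' g g' h h' : K) :
  t1 + s1 + (t2 + s2) + (t3 + s3) =
  t1 + (s1 + f - g) + (- h' - - h) + (t2 + (s2 + g' - h) + (- f - - f'))
    + (t3 + (s3 + h' - f') + (- g' - - g)).
  by ring.
congr (_, _); first exact: lie_jacobi.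
apply/lfunP=> z; have /lfunP/(_ z) := cocycle2_eq theta u.1 v.1 w.1.
rewrite !(lfun_simp, adE) /= !lie_lie !linearB /= => <-; symmetry.
exact: aux.
Qed.

HB.instance Definition _ := Vector_isLieAlgebra.Build K (tstar charK theta)
  tstar_liexx tstar_jacobi.

Fact tstar_form_bilinear :
  bilinear_for (GRing.mul : K -> K -> K) (idfun \; *%R) tstar_form.
Proof.
have aux (k f f' g g' : K) :
  k * f + f' + (k * g + g') = k * (f + g) + (f' + g') by ring.
split=> [v k u w|u k v w]; rewrite /tstar_form /= !(lfun_simp, linearP) /=;
  exact: aux.
Qed.

HB.instance Definition _ :=
  bilinear_isBilinear.Build K (tstar charK theta) (tstar charK theta) K
    *%R (idfun \; *%R) tstar_form tstar_form_bilinear.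

Fact tstar_formC u v : tstar_form u v = (-1) ^+ false * idfun (tstar_form v u).
Proof. by rewrite mul1r /tstar_form addrC. Qed.

HB.instance Definition _ :=
  isHermitianSesquilinear.Build K (tstar charK theta) false idfun tstar_form
    tstar_formC.

Fact tstar_form_nondegenerate : nondegenerate (tstar_form : {symmetric _}).
Proof.
rewrite /nondegenerate -subv0; apply/subvP=> -[x f] /mem_orthovP xf0.
have f0 : f = 0.
  apply/lfunP=> y; rewrite zero_lfunE.
  have e : f y + (0 : 'Hom(a, K^o)) x = 0 := xf0 (y, 0) (memvf _).
  by rewrite zero_lfunE addr0 in e.
have x0 : x = 0.
  rewrite (coord_vbasis (memvf x)) big1 // => i _.
  pose g : 'Hom(a, K^o) := linfun (coord (vbasis fullv) i : a -> K^o).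
  have e : f 0 + g x = 0 := xf0 (0, g) (memvf _).
  by move: e; rewrite linear0 add0r lfunE /= => ->; rewrite scale0r.
by rewrite f0 x0 mem0v.
Qed.

Fact tstar_form_invariant (cyc : cyclic_cocycle theta) u v w :
  tstar_form (lie u v) w = tstar_form u (lie v w).
Proof.
rewrite /tstar_form /= !(lfun_simp, adE) /= (lieC w.1) (lieC v.1 u.1) (linearN v.2) (linearN w.2).
rewrite -(cyc u.1).
have aux (t f g h : K) : t + f - g + h = f + (t + - g - - h) by ring.
exact: aux.
Qed.
End TstarExtension.

Section CyclicTstar.
Variables (K : fieldType) (a : lieAlgType K) (charK : [pchar K] =i pred0).
Variables (theta : coad_cocycle2 a) (cyc : cyclic_cocycle theta).

Definition quad_tstar of cyclic_cocycle theta : Type := tstar charK theta.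

HB.instance Definition _ := LieAlgebra.on (quad_tstar cyc).

HB.instance Definition _ := LieAlgebra_isQuadratic.Build K (quad_tstar cyc)
  (tstar_form_nondegenerate charK theta) (tstar_form_invariant cyc).
End CyclicTstar.

(* Main.v *)
Require Import Defs.
From HB Require Import structures.
From mathcomp Require Import all_boot all_order all_algebra.
From mathcomp Require Import sesquilinear ring.
Import GRing.Theory.
Local Open Scope ring_scope.

(** The derivation [D] extends to the endomorphism [x + f |-> - D x + f \o D]
    of the vector space [T^*_theta a]; it is skew for the canonical form [B],
    hence composing it with [B] gives the skew form
    [w0 (x + f, y + g) = f (D y) - g (D x)], non-degenerate because [D] is
    invertible.  In the cyclic sum of [w0 ([u, v], w)] the terms linear in the
    [a^*] components cancel because [D] is a derivation.  By cyclicity of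
    [theta], what remains depends only on the [a] components and is exactly
    [Theta].  So [w0] fails to be closed by a 3-form pulled back from [a]; if
    that form is the coboundary of [F], subtracting the pullback of [F] closes
    it ([tstar_sympl_closed]).  The correction does not affect non-degeneracy
    ([tstar_sympl_nondegenerate]): it pairs [a] with [a] only, whereas the
    pairing of [a] with the isotropic subspace [a^*] is already perfect. *)

Lemma dual_separates (K : fieldType) (V : vectType K) (x : V) :
  (forall g : 'Hom(V, K^o), g x = 0) -> x = 0.
Proof.
move=> gx0; rewrite (coord_vbasis (memvf x)) big1 // => i _.
have := gx0 (linfun (coord (vbasis fullv) i : V -> K^o)).
by rewrite lfunE /= => ->; rewrite scale0r.
Qed.

Section SymplecticForm.
Context {K : fieldType} {charK : [pchar K] =i pred0} {a : lieAlgType K}.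
Context {theta : coad_cocycle2 a}.
Variables (D : 'End(a)) (F : {biscalar a}).

Local Notation T := (tstar charK theta).

Definition tstar_sympl (u v : T) : K := u.2 (D v.1) - v.2 (D u.1) - F u.1 v.1.

Lemma tstar_sympl_bilinear :
  bilinear_for (GRing.mul : K -> K -> K) (idfun \; *%R) tstar_sympl.
Proof.
have aux (k f f' g g' h h' : K) :
  k * f + f' + (k * - g - g') - (k * h + h') = k * (f - g - h) + (f' - g' - h').
  by ring.
split=> [v k u w|u k v w]; rewrite /tstar_sympl /=;
  rewrite ?(linearPl F) ?(linearPr F) !(lfun_simp, linearP) /=; exact: aux.
Qed.

Hypothesis Falt : forall x, F x x = 0.

Lemma tstar_sympl_skew u v :
  tstar_sympl u v = (-1) ^+ true * idfun (tstar_sympl v u).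
Proof.
have FC x y : F x y = - F y x.
  apply/eqP; rewrite -addr_eq0; have := Falt (x + y).
  by rewrite linearDl /= !linearDr /= !Falt add0r addr0 => ->.
by rewrite /tstar_sympl /= (FC v.1); ring.
Qed.

(** Pairing [x + f] with [a^*] first gives [D x = 0], hence [x = 0]; only then
    does the term in [F] vanish, and pairing with [a] gives [f \o D = 0]. *)
Lemma tstar_sympl_nondegenerate (invD : bijective D) (u : T) :
  (forall v, tstar_sympl u v = 0) -> u = 0.
Proof.
case: u => x f w0; case: invD => E DK EK.
have x0 : x = 0.
  apply: (can_inj DK); rewrite linear0; apply: dual_separates => g.
  have := w0 (0, g); rewrite /tstar_sympl /= (linear0r F) subr0 !linear0 add0r.
  by move/eqP; rewrite oppr_eq0 => /eqP.
congr (_, _) => //; apply/lfunP=> y; rewrite zero_lfunE.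
have := w0 (E y, 0); rewrite /tstar_sympl /= x0 (linear0l F) EK.
by rewrite zero_lfunE !subr0.
Qed.

(** The cyclic sums of [theta (x, y) (D z)] and of [theta (D x, y) z] agree
    because [theta] is cyclic, so [F] compensates the contribution of
    [theta]. *)
Lemma tstar_sympl_closed (derD : derivation D) (cyc : cyclic_cocycle theta)
    (ThetaF : forall x y z,
       theta (D x) y z + theta (D y) z x + theta (D z) x y =
       F (lie x y) z + F (lie y z) x + F (lie z x) y) (u v w : T) :
  tstar_sympl (lie u v) w + tstar_sympl (lie v w) u
    + tstar_sympl (lie w u) v = 0.
Proof.
have aux (t1 t2 t3 f f' g g' h h' b1 b2 b3 : K) :
    t3 + f - g - (h - h') - b1 + (t1 + g' - h' - (f - f') - b2)
      + (t2 + h - f' - (g' - g) - b3) =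
    (t1 + t2 + t3) - (b1 + b2 + b3) by ring.
case: u v w => [x f] [y g] [z h]; rewrite /tstar_sympl /=.
have derl s t (k : 'Hom(a, K^o)) :
    k (D (lie s t)) = k (lie s (D t)) - k (lie t (D s)).
  by rewrite derD linearD /= (lieC (D s)) (linearN k) addrC.
rewrite !(lfun_simp, adE) /= !derl.
rewrite -(cyc (D z)) -(cyc (D x)) -(cyc (D y)).
by apply/eqP; rewrite aux ThetaF subrr.
Qed.

End SymplecticForm.

Theorem proposition2p2 (K : fieldType) (charK : [pchar K] =i pred0)
    (a : lieAlgType K) (D : 'End(a)) (derD : derivation D) (invD : bijective D)
    (theta : coad_cocycle2 a) (cyc : cyclic_cocycle theta)
    (Theta_cobound : coboundary3
      (fun x y z => theta (D x) y z + theta (D y) z x + theta (D z) x y)) :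
  exists w : {skew_symmetric (quad_tstar charK cyc)}, symplectic_structure w.
Proof.
case: Theta_cobound => F [Falt ThetaF].
pose T := quad_tstar charK cyc; pose w : T -> T -> K := tstar_sympl D F.
pose bilin := bilinear_isBilinear.Build K T T K *%R (idfun \; *%R) w
  (tstar_sympl_bilinear D F).
pose wb : {bilinear T -> T -> K | *%R & (idfun \; *%R)} := HB.pack w bilin.
pose skew := isHermitianSesquilinear.Build K T true idfun wb
  (tstar_sympl_skew D F Falt).
pose ws : {skew_symmetric T} := HB.pack w bilin skew.
exists ws; split; last exact: tstar_sympl_closed.
rewrite /nondegenerate -subv0; apply/subvP=> u /mem_orthovP u_ortho.
rewrite (tstar_sympl_nondegenerate D F invD u) ?mem0v // => v.
exact: u_ortho (memvf _).
Qed.
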